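(* Let $t$ be a positive integer, and let $G$ be a connected graph of order $n \geq t+2$. Let $\eta(t,n)$ denote the largest real root of the equation $x^{3}-(n-t-2)x^{2}-(n-1)x+t(n-t-2)=0$. If $\lambda_1(G)\geq \eta(t,n)$, then $G$ is a $\frac{1}{t}$-tough graph unless $G = K_1\vee(K_{n-t-1}\cup tK_1)$.
   Context: All graphs are finite, simple and undirected. $\lambda_1(G)$ denotes the spectral radius of $G$, i.e. the largest eigenvalue of its adjacency matrix $A(G)$. For a graph $G$ and $S\subseteq V(G)$, $c(G-S)$ denotes the number of connected components of the graph obtained from $G$ by deleting $S$ and all incident edges. A graph $G$ is $\frac{1}{t}$-tough if $|S|\geq \frac{1}{t}\,c(G-S)$ for every subset $S\subseteq V(G)$ with $c(G-S)\geq 2$. $K_m$ is the complete graph on $m$ vertices, $tK_1$ is the graph consisting of $t$ isolated vertices, $G_1\cup G_2$ is the disjoint union of two graphs, and $G_1\vee G_2$ (the join) is obtained from $G_1\cup G_2$ by adding all edges between $V(G_1)$ and $V(G_2)$. *)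

(* Defs.v *)
From HB Require Import structures.
From mathcomp Require Import all_boot all_order all_algebra.
From mathcomp Require Import boolp classical_sets reals.

Set Implicit Arguments.
Unset Strict Implicit.
Unset Printing Implicit Defensive.

Import Order.TTheory GRing.Theory Num.Theory.

Local Open Scope ring_scope.

Record sgraph := SGraph {
  vertex :> finType;
  adj : rel vertex;
  adj_sym : symmetric adj;
  adj_irr : irreflexive adj
}.

Arguments adj {s}.

Definition isomorphic (G H : sgraph) : Prop :=
  exists2 f : G -> H, bijective f & forall x y, adj (f x) (f y) = adj x y.

Definition connected_graph (G : sgraph) : Prop :=
  forall x y : G, connect adj x y.

Definition components (G : sgraph) : nat := n_comp adj G.

Section Delete.
Variables (G : sgraph) (S : {set G}).

Definition delete_adj : rel {x : G | x \notin S} :=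
  fun x y => adj (val x) (val y).

Lemma delete_sym : symmetric delete_adj.
Proof. by move=> x y; rewrite /delete_adj adj_sym. Qed.

Lemma delete_irr : irreflexive delete_adj.
Proof. by move=> x; rewrite /delete_adj adj_irr. Qed.

Definition delete : sgraph := SGraph delete_sym delete_irr.

End Delete.

Definition tough (R : realType) (tau : R) (G : sgraph) : Prop :=
  forall S : {set G}, (2 <= components (delete S))%N ->
    tau * (components (delete S))%:R <= #|S|%:R.

Section Complete.
Variable m : nat.

Definition complete_adj : rel 'I_m := fun x y => x != y.

Lemma complete_sym : symmetric complete_adj.
Proof. by move=> x y; rewrite /complete_adj eq_sym. Qed.

Lemma complete_irr : irreflexive complete_adj.
Proof. by move=> x; rewrite /complete_adj eqxx. Qed.

Definition complete : sgraph := SGraph complete_sym complete_irr.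

End Complete.

Section Edgeless.
Variable m : nat.

Definition edgeless_adj : rel 'I_m := fun _ _ => false.

Lemma edgeless_sym : symmetric edgeless_adj.
Proof. by []. Qed.

Lemma edgeless_irr : irreflexive edgeless_adj.
Proof. by []. Qed.

Definition edgeless : sgraph := SGraph edgeless_sym edgeless_irr.

End Edgeless.

Section UnionJoin.
Variables G H : sgraph.

(* [b] tells whether the two sides are completely joined to each other. *)
Definition sum_adj (b : bool) : rel (G + H)%type := fun u v =>
  match u, v with
  | inl x, inl y => adj x y
  | inr x, inr y => adj x y
  | _, _ => b
  end.

Lemma sum_sym b : symmetric (sum_adj b).
Proof. by move=> [x|x] [y|y] //=; rewrite adj_sym. Qed.

Lemma sum_irr b : irreflexive (sum_adj b).
Proof. by move=> [x|x] /=; rewrite adj_irr. Qed.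

Definition graph_union : sgraph := SGraph (sum_sym false) (sum_irr false).
Definition graph_join : sgraph := SGraph (sum_sym true) (sum_irr true).

End UnionJoin.

(* The greatest element of A; the default 0 is returned only when A has none. *)
Definition largest (R : realType) (A : set R) : R :=
  xget 0 (A `&` ubound A)%classic.

Lemma largestE (R : realType) (A : set R) (x : R) :
  A x -> ubound A x -> largest A = x.
Proof.
move=> Ax ubx; rewrite /largest.
case: xgetP => [y _ [Ay uby]|/(_ x) []//].
by apply/le_anti; rewrite ubx// uby.
Qed.

Definition adj_matrix (R : realType) (G : sgraph) : 'M[R]_#|G| :=
  \matrix_(i, j) (adj (enum_val i) (enum_val j))%:R.

Definition lambda1 (R : realType) (G : sgraph) : R :=
  largest (fun x : R => eigenvalue (adj_matrix R G) x).

Definition eta (R : realType) (t n : nat) : R :=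
  largest (fun x : R =>
    x ^+ 3 - (n%:R - t%:R - 2) * x ^+ 2 - (n%:R - 1) * x
      + t%:R * (n%:R - t%:R - 2) = 0).

(* Main.v *)
Require Import Defs.
From mathcomp Require Import all_boot all_order all_algebra.
From mathcomp Require Import boolp reals zify ring lra.
From mathcomp Require classical_sets polyrcf.

(** Suppose [S], of size [s], violates toughness: [G - S] has more than [t s]
    components.  Let [n_x] be the size of the component of [x] in [G - S], and
    for [mu > 0] let [y] be [1] on [S] and [s / (mu + 1 - n_x)] off [S].  Then
    [A y <= mu y] holds off [S] automatically, and on [S] the convexity of
    [z / (mu + 1 - z)] shows that the worst case is one component of size
    [M = n - s - t s] and [t s] singletons, so that it suffices to have
    [s - 1 + s (t s / mu + M / (mu + 1 - M)) <= mu].  A positive [y] with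
    [A y <= mu y] bounds every eigenvalue by [mu], and if [mu] is attained in a
    connected graph then [A y = mu y].

    If [s >= 2], [mu = n - t - 1] is admissible, and the cubic is [-t < 0]
    there, so [lambda1 <= n - t - 1 < eta].  If [s = 1], the condition on [mu]
    is exactly that the cubic vanishes, so [mu = eta] is admissible, and the
    equality case forces the extremal graph. *)

Set Implicit Arguments.
Unset Strict Implicit.
Unset Printing Implicit Defensive.

Import Order.TTheory GRing.Theory Num.Theory.

Local Open Scope ring_scope.

(** * Largest roots and the location of [eta] *)

Lemma largestP (R : realType) (A : classical_sets.set R) :
  (exists2 x, A x & classical_sets.ubound A x) -> A (largest A) /\ classical_sets.ubound A (largest A).
Proof. by move=> [x Ax ubx]; rewrite (largestE Ax ubx). Qed.

Lemma seq_max (R : realType) (s : seq R) (x : R) :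
  x \in s -> exists2 m, m \in s & {in s, forall y, y <= m}.
Proof.
elim: s x => // a s IH x _; case: s IH => [_|b s IH].
  by exists a; rewrite ?mem_head // => y; rewrite inE => /eqP->.
have [m ms mub] := IH b (mem_head _ _).
exists (Num.max a m).
  by rewrite maxEle; case: ifP; rewrite inE ?ms ?eqxx ?orbT.
by move=> y; rewrite inE le_max => /orP[/eqP->|/mub->]; rewrite ?lexx ?orbT.
Qed.

(** A nonzero polynomial has finitely many roots, so as soon as there is one root there is a
    greatest one, and [largest] does not fall back on its default. *)
Lemma largest_root (R : realType) (p : {poly R}) (x : R) :
  p != 0 -> root p x ->
  exists2 m, root p m & forall y, root p y -> y <= m.
Proof.
move=> p0 px; have rE y : (y \in polyrcf.rootsR p) = root p y.
  by have := @polyrcf.roots_on_rootsR _ _ p0 y; rewrite in_itv.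
have [|m] := @seq_max _ (polyrcf.rootsR p) x; first by rewrite rE.
by rewrite rE => pm ub; exists m => // y; rewrite -rE => /ub.
Qed.

Definition eta_poly (R : realType) (t n : nat) : {poly R} :=
  'X^3 - (n%:R - t%:R - 2)%:P * 'X^2 - (n%:R - 1)%:P * 'X
    + (t%:R * (n%:R - t%:R - 2))%:P.

Lemma horner_eta_poly (R : realType) (t n : nat) (x : R) :
  (eta_poly R t n).[x] = x ^+ 3 - (n%:R - t%:R - 2) * x ^+ 2 - (n%:R - 1) * x
      + t%:R * (n%:R - t%:R - 2).
Proof. by rewrite /eta_poly !hornerE. Qed.

(** The cubic equals -t at n - t - 1 and is nonnegative at n, so the intermediate value theorem
    gives a root at or beyond n - t - 1; equality is excluded by the value -t. *)
Lemma etaP (R : realType) (t n : nat) : (0 < t)%N -> (t + 2 <= n)%N ->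
  n%:R - t%:R - 1 < eta R t n /\
  eta R t n ^+ 3 - (n%:R - t%:R - 2) * eta R t n ^+ 2 - (n%:R - 1) * eta R t n
    + t%:R * (n%:R - t%:R - 2) = 0.
Proof.
move=> t0 tn; have t1 : 1 <= t%:R :> R by rewrite ler1n.
have tn' : t%:R + 2 <= n%:R :> R by rewrite -natrD ler_nat.
pose rho : R := n%:R - t%:R - 1.
have p_rho : (eta_poly R t n).[rho] = - t%:R.
  by rewrite horner_eta_poly /rho; ring.
have p_n : 0 <= (eta_poly R t n).[n%:R].
  rewrite horner_eta_poly; nra.
have [|/=|x /andP[rx _] px] := @Num.Theory.poly_ivt R (eta_poly R t n) rho n%:R.
- by rewrite /rho; lra.
- by rewrite p_rho p_n andbT; lra.
have p0 : eta_poly R t n != 0.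
  by apply/eqP => p0; move: p_rho; rewrite p0 horner0; lra.
have [m pm mub] := largest_root p0 px.
have [|] := @largestP R (fun x : R =>
    x ^+ 3 - (n%:R - t%:R - 2) * x ^+ 2 - (n%:R - 1) * x
      + t%:R * (n%:R - t%:R - 2) = 0).
  exists m => [|y yP]; first by move/rootP: pm; rewrite horner_eta_poly.
  by apply: mub; apply/rootP; rewrite horner_eta_poly.
rewrite -/(eta R t n) => eta_eq /(_ x) eta_ub; split=> //.
have {}eta_ub : x <= eta R t n.
  by apply: eta_ub; move/rootP: px; rewrite horner_eta_poly.
rewrite lt_neqAle (le_trans rx eta_ub) andbT; apply/eqP => E; have := p_rho.
by rewrite /rho E horner_eta_poly eta_eq; lra.
Qed.

(** * Eigenvalues and positive superharmonic vectors *)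

(** Positivity excludes the default value 0 of [largest]. *)
Lemma lambda1_eigenvalue (R : realType) (G : sgraph) :
  0 < lambda1 R G -> eigenvalue (adj_matrix R G) (lambda1 R G).
Proof.
by rewrite /lambda1 /largest; case: classical_sets.xgetP => [x -> []|_]//;
  rewrite ltxx.
Qed.

Lemma adj_eigenvector (R : realType) (G : sgraph) (a : R) :
  eigenvalue (adj_matrix R G) a ->
  exists2 x : G -> R, exists u, x u != 0 &
    forall u, \sum_(w | adj u w) x w = a * x u.
Proof.
move=> /eigenvalueP[v vA v0]; exists (fun u => v 0 (enum_rank u)).
  have /rV0Pn[i vi] := v0; exists (enum_val i).
  by rewrite enum_valK.
move=> u; have := congr1 (fun w : 'rV_#|G| => w 0 (enum_rank u)) vA.
rewrite !mxE => <-; rewrite (reindex (@enum_val G predT)) /=; last first.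
  by exists enum_rank => ? _; [exact: enum_valK|exact: enum_rankK].
rewrite big_mkcond /=; apply: eq_bigr => i _.
rewrite mxE enum_rankK adj_sym enum_valK.
by case: adj; rewrite ?mulr1 ?mulr0.
Qed.

(* Pairing the superharmonic y with the subharmonic |x| of an eigenvector x
   leaves no slack on either side; connectedness makes |x| positive. *)
Lemma superharmonic_eq (R : realType) (G : sgraph) (y : G -> R) (mu lam : R) :
  connected_graph G -> (forall u, 0 < y u) ->
  (forall u, \sum_(w | adj u w) y w <= mu * y u) ->
  eigenvalue (adj_matrix R G) lam -> mu <= lam ->
  lam = mu /\ forall u, \sum_(w | adj u w) y w = mu * y u.
Proof.
move=> Gc y0 yle /adj_eigenvector[x [u0 xu0] xE] mulam.
pose z u : R := `|x u|; have z0 u : 0 <= z u by apply: normr_ge0.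
have zE u : lam * z u <= \sum_(w | adj u w) z w.
  apply: le_trans (ler_norm_sum _ _ _); rewrite xE normrM.
  by rewrite ler_wpM2r // ler_norm.
have swap : \sum_u z u * (\sum_(w | adj u w) y w) =
            \sum_u y u * (\sum_(w | adj u w) z w).
  under eq_bigr do rewrite mulr_sumr big_mkcond.
  rewrite exchange_big /=; apply: eq_bigr => u _.
  rewrite mulr_sumr [RHS]big_mkcond; apply: eq_bigr => w _.
  by rewrite adj_sym mulrC.
have d1 u : true -> 0 <= z u * (mu * y u - \sum_(w | adj u w) y w).
  by move=> _; rewrite mulr_ge0 // subr_ge0.
have d2 u : true -> 0 <= y u * (\sum_(w | adj u w) z w - lam * z u).
  by move=> _; rewrite mulr_ge0 ?subr_ge0 //; exact: ltW.
have d3 u : true -> 0 <= (lam - mu) * (y u * z u).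
  by move=> _; rewrite !mulr_ge0 ?subr_ge0 //; exact: ltW.
(* Three nonnegative sums that cancel by the symmetry of adjacency: each of them vanishes, and so
   does each of their terms. *)
have tot : \sum_u z u * (mu * y u - \sum_(w | adj u w) y w) +
   \sum_u y u * (\sum_(w | adj u w) z w - lam * z u) +
   \sum_u (lam - mu) * (y u * z u) = 0.
  rewrite (eq_bigr (fun u => mu * (y u * z u) - z u * \sum_(w | adj u w) y w));
    last by move=> u _; ring.
  rewrite sumrB swap -sumrB -!big_split /= big1 // => u _; ring.
have s1 := sumr_ge0 (P := xpredT) (index_enum G) d1.
have s2 := sumr_ge0 (P := xpredT) (index_enum G) d2.
have s3 := sumr_ge0 (P := xpredT) (index_enum G) d3.
have e1 : \sum_u z u * (mu * y u - \sum_(w | adj u w) y w) = 0 by lra.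
have e2 : \sum_u y u * (\sum_(w | adj u w) z w - lam * z u) = 0 by lra.
have e3 : \sum_u (lam - mu) * (y u * z u) = 0 by lra.
have {e2} zh u : \sum_(w | adj u w) z w = lam * z u.
  have /eqP := psumr_eq0P (P := xpredT) d2 e2 (i := u) isT.
  by rewrite mulf_eq0 gt_eqF //= subr_eq0 => /eqP.
have zpos u : 0 < z u.
  rewrite lt_neqAle z0 andbT eq_sym; apply/eqP => zu.
  (* Where [z] vanishes, its neighbour sum vanishes, hence so does [z] at every neighbour; by
     connectedness a single zero would kill the eigenvector. *)
  have cl : closed adj [pred w | z w == 0].
    have cl1 a b : adj a b -> z a == 0 -> z b == 0.
      move=> ab /eqP za; apply/eqP.
      by apply: (psumr_eq0P (P := adj a) _ _ ab) => [//|]; rewrite zh za mulr0.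
    move=> a b ab; rewrite !inE; apply/idP/idP; apply: cl1 => //.
    by rewrite adj_sym.
  have := closed_connect cl (Gc u u0); rewrite !inE zu eqxx => /esym.
  by rewrite normr_eq0 (negPf xu0).
split.
  have /eqP := psumr_eq0P (P := xpredT) d3 e3 (i := u0) isT.
  by rewrite mulf_eq0 (gt_eqF (mulr_gt0 (y0 u0) (zpos u0))) orbF subr_eq0 => /eqP.
move=> u; have /eqP := psumr_eq0P (P := xpredT) d1 e1 (i := u) isT.
by rewrite mulf_eq0 gt_eqF //= subr_eq0 => /eqP.
Qed.

(** * Sizes and number of connected components *)

Section ComponentSizes.
Variable H : sgraph.

Definition component (x : H) : {set H} := [set y | connect adj x y].

Lemma connect_adj_sym : connect_sym (@adj H).
Proof. exact: sym_connect_sym (@adj_sym H). Qed.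

Lemma component_eq (x y : H) : connect adj x y -> component x = component y.
Proof. by move=> xy; apply/setP => z; rewrite !inE (same_connect connect_adj_sym xy). Qed.

Lemma component_gt0 (x : H) : (0 < #|component x|)%N.
Proof. by apply/card_gt0P; exists x; rewrite inE. Qed.

Lemma componentsE : components H = #|fingraph.roots (@adj H)|.
Proof. by rewrite /components /n_comp_mem; apply: eq_card => x; rewrite !inE andbT. Qed.

Lemma sum_components (V : nmodType) (F : H -> V) :
  (forall x y, connect adj x y -> F x = F y) ->
  \sum_x F x = \sum_(r | fingraph.roots adj r) F r *+ #|component r|.
Proof.
move=> Fc; rewrite (partition_big (fingraph.root adj) (fingraph.roots adj)) /=;
  last by move=> x _; exact/roots_root/connect_adj_sym.
apply: eq_bigr => r /eqP rr; rewrite -sumr_const.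
apply: eq_big => [x|x /eqP E]; last first.
  by apply: Fc; rewrite -(root_connect connect_adj_sym) E rr.
by rewrite inE -(root_connect connect_adj_sym) rr eq_sym.
Qed.

(** Counting excesses over one vertex per component lets the next bounds follow by isolating terms
    of this sum. *)
Lemma card_components :
  #|H| = (components H + \sum_(r | fingraph.roots (@adj H) r) #|component r|.-1)%N.
Proof.
rewrite componentsE -!sum1_card -big_split /=.
have := @sum_components nat (fun=> 1%N) (fun _ _ _ => erefl).
have -> : \sum_(x : H) 1%N = (\sum_(x : H) 1)%N :> nat by [].
move=> ->; apply: eq_bigr => r _.
by rewrite -mulr_natr mul1r natn add1n prednK ?component_gt0.
Qed.

Lemma card_component_le (x : H) : (#|component x| + components H <= #|H|.+1)%N.
Proof.
rewrite (component_eq (connect_root _ x)) card_components.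
rewrite (bigD1 (fingraph.root adj x)) /=; last exact/roots_root/connect_adj_sym.
by have := component_gt0 (fingraph.root adj x); lia.
Qed.

(** Equality case of [card_component_le]: the component of [x] takes up the whole excess, leaving
    none for the others. *)
Lemma one_big_component (x y : H) : (#|component x| + components H = #|H|.+1)%N ->
  ~~ connect adj x y -> component y = [set y].
Proof.
move=> xc xy; apply/eqP; rewrite eq_sym eqEcard sub1set inE connect0 cards1 /=.
move: xc; rewrite (component_eq (connect_root _ x)) (component_eq (connect_root _ y)).
rewrite card_components (bigD1 (fingraph.root adj x)) /=; last exact/roots_root/connect_adj_sym.
rewrite (bigD1 (fingraph.root adj y)) /=; last first.
  by rewrite (roots_root connect_adj_sym) (root_connect connect_adj_sym) connect_adj_sym.
have := component_gt0 (fingraph.root adj x).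
by lia.
Qed.

Lemma all_singletons : (forall x : H, #|component x| = 1%N) -> #|H| = components H.
Proof. by move=> c1; rewrite card_components big1 ?addn0 // => r _; rewrite c1. Qed.

End ComponentSizes.

(** * The convexity bound on the total weight *)

(* The gap between the convex [z / (mu + 1 - z)] and its chord over [1, M]. *)
Lemma chord_gap (R : realType) (mu M z : R) : 0 < mu -> M < mu + 1 -> z < mu + 1 ->
  mu^-1 + (z - 1) * ((mu + 1) / (mu * (mu + 1 - M))) - z / (mu + 1 - z) =
  (mu + 1) / (mu * (mu + 1 - M) * (mu + 1 - z)) * ((z - 1) * (M - z)).
Proof. by move=> mu0 M1 z1; field; rewrite !gt_eqF //= ?subr_gt0. Qed.

Section WeightSum.
Variables (R : realType) (H : sgraph) (q : nat) (mu : R).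
Hypotheses (mu0 : 0 < mu) (q_lt : (q < components H)%N).
Let M : nat := (#|H| - q)%N.
Hypothesis M_lt : M%:R < mu + 1.

(** For a component of size k this is the solution w of mu w = 1 + (k - 1) w: up to the factor |S|,
    the eigenvalue equation at a vertex adjacent to all of S and to the rest of its component. *)
Definition weight (x : H) : R := (mu + 1 - #|component x|%:R)^-1.

Lemma component_leM (x : H) : (#|component x| <= M)%N.
Proof. by rewrite /M; have := card_component_le x; move: q_lt; lia. Qed.

Lemma component_lt (x : H) : #|component x|%:R < mu + 1.
Proof. by apply: le_lt_trans M_lt; rewrite ler_nat component_leM. Qed.

Lemma weight_gt0 (x : H) : 0 < weight x.
Proof. by rewrite invr_gt0 subr_gt0 component_lt. Qed.

Lemma weight_eq (x y : H) : connect adj x y -> weight x = weight y.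
Proof. by rewrite /weight => /component_eq ->. Qed.

(** Slope of the chord of z / (mu + 1 - z) between z = 1 and z = M, with M - 1 cancelled so that it
    also makes sense for M = 1. *)
Let sigma : R := (mu + 1) / (mu * (mu + 1 - M%:R)).
Let gap (r : H) : R := mu^-1 + (#|component r|%:R - 1) * sigma
  - #|component r|%:R / (mu + 1 - #|component r|%:R).

Let gapE (r : H) : gap r = (mu + 1) / (mu * (mu + 1 - M%:R) * (mu + 1 - #|component r|%:R))
   * ((#|component r|%:R - 1) * (M%:R - #|component r|%:R)).
Proof. by rewrite /gap chord_gap // component_lt. Qed.

Let coef_gt0 (r : H) : 0 < (mu + 1) / (mu * (mu + 1 - M%:R) * (mu + 1 - #|component r|%:R)).
Proof.
rewrite divr_gt0 // ?mulr_gt0 ?subr_gt0 ?component_lt //; by move: mu0; lra.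
Qed.

Let gap_ge0 (r : H) : 0 <= gap r.
Proof.
rewrite gapE; apply: mulr_ge0; first exact/ltW/coef_gt0.
apply: mulr_ge0; rewrite subr_ge0.
- by rewrite ler1n component_gt0.
- by rewrite ler_nat component_leM.
Qed.

Let M_gt0 : (0 < M)%N.
Proof. by rewrite /M; have := card_components H; move: q_lt; lia. Qed.

Let sigma_gt : mu^-1 < sigma.
Proof.
have M1 : 1 <= M%:R :> R by rewrite ler1n.
have -> : sigma = mu^-1 * ((mu + 1) / (mu + 1 - M%:R)).
  by rewrite /sigma; field; rewrite !gt_eqF // subr_gt0.
by rewrite ltr_pMr ?invr_gt0 // ltr_pdivlMr ?subr_gt0 //; move: M1; lra.
Qed.

(** The chord, summed over components, depends only on their number and on |H|. The deficit from the
    extremal value thus splits into a cost for each component beyond q + 1 and the convexity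
    gaps. *)
Let weight_sumE : \sum_x weight x = q%:R / mu + M%:R / (mu + 1 - M%:R)
  - ((components H - q.+1)%:R * (sigma - mu^-1)
     + \sum_(r | fingraph.roots adj r) gap r).
Proof.
have -> : \sum_(r | fingraph.roots adj r) gap r =
   (components H)%:R / mu + (#|H|%:R - (components H)%:R) * sigma - \sum_x weight x.
  rewrite (sum_components weight_eq) sumrB big_split /=; congr (_ + _ - _).
  - by rewrite sumr_const -componentsE mulr_natl.
  - rewrite -mulr_suml; congr (_ * _).
    rewrite card_components natrD addrAC subrr add0r natr_sum.
    apply: eq_bigr => r _.
    by rewrite -[in LHS](prednK (component_gt0 r)) -natr1 addrK.
  - by apply: eq_bigr => r _; rewrite -[RHS]mulr_natl.
have cN : (components H <= #|H|)%N by rewrite card_components leq_addr.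
have -> : #|H|%:R = M%:R + q%:R :> R.
  by rewrite -natrD /M subnK //; move: q_lt cN; lia.
rewrite [(components H - _)%:R]natrB // -[q.+1%:R]natr1 /sigma.
by field; rewrite !gt_eqF // subr_gt0.
Qed.

Lemma weight_sum_le : \sum_x weight x <= q%:R / mu + M%:R / (mu + 1 - M%:R).
Proof.
rewrite weight_sumE gerBl addr_ge0 // ?sumr_ge0 // mulr_ge0 // subr_ge0.
exact: ltW.
Qed.

Lemma weight_sum_eq : \sum_x weight x = q%:R / mu + M%:R / (mu + 1 - M%:R) ->
  components H = q.+1 /\ exists x : H, #|component x| = M.
Proof.
rewrite weight_sumE => E.
have g0 : 0 <= \sum_(r | fingraph.roots (@adj H) r) gap r by apply: sumr_ge0.
have s0 : 0 < sigma - mu^-1 by rewrite subr_gt0.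
have c0 : 0 <= (components H - q.+1)%:R * (sigma - mu^-1) by apply: mulr_ge0 => //; exact: ltW.
have cE : components H = q.+1.
  have /eqP : (components H - q.+1)%:R * (sigma - mu^-1) = 0 by move: E g0 c0; lra.
  by rewrite mulf_eq0 (gt_eqF s0) orbF pnatr_eq0; move: q_lt; lia.
have gE : \sum_(r | fingraph.roots (@adj H) r) gap r = 0 by move: E g0 c0; lra.
(* A zero gap means (z - 1)(M - z) = 0 for the component size z. *)
have dich (x : H) : #|component x| = 1%N \/ #|component x| = M.
  rewrite (component_eq (connect_root _ x)).
  have xr : fingraph.roots adj (fingraph.root adj x) by exact/roots_root/connect_adj_sym.
  have /eqP := psumr_eq0P (fun r _ => gap_ge0 r) gE xr.
  rewrite gapE mulf_eq0 gt_eqF //= mulf_eq0 !subr_eq0 pnatr_eq1 eqr_nat.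
  by case/orP => /eqP E1; [left|right].
(* If no component had size M, all would be singletons, so |H| = q + 1 and M = 1, a
   contradiction. *)
split=> //; apply: contrapT => nM.
have c1 (x : H) : #|component x| = 1%N.
  by case: (dich x) => // xM; case: nM; exists x.
have M1 : M = 1%N by rewrite /M all_singletons // cE subSnn.
have /card_gt0P[x _] : (0 < #|H|)%N by move: M_gt0; rewrite /M; lia.
by apply: nM; exists x; rewrite c1 M1.
Qed.

End WeightSum.

(** * Deleting a vertex set *)

Lemma card_delete (G : sgraph) (S : {set G}) : (#|S| + #|delete S|)%N = #|G|.
Proof.
rewrite -(cardsC S) /= card_sig; congr (_ + _)%N.
by apply: eq_card => x; rewrite !inE.
Qed.

Lemma separator_neq0 (G : sgraph) (S : {set G}) :
  connected_graph G -> (1 < components (delete S))%N -> S != set0.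
Proof.
move=> Gc; rewrite componentsE; apply: contraTneq => S0; rewrite -leqNgt.
have nS x : x \notin S by rewrite S0 inE.
pose d x : delete S := Sub x (nS x).
have dc (x y : delete S) : connect adj x y.
  (* With S empty, the vertices whose copy is reachable from [x] form a set closed under adjacency
     in [G], hence all of [G]. *)
  pose a := [pred z | connect adj x (d z)].
  have cl : closed adj a.
    move=> u v uv; rewrite !inE; apply: same_connect_r; first exact: connect_adj_sym.
    exact: connect1.
  have dK z : d (val z) = z by apply: val_inj.
  have := closed_connect cl (Gc (val x) (val y)).
  by rewrite !inE !dK connect0.
apply/card_le1_eqP => x y; rewrite !unfold_in => /eqP <- /eqP <-.
exact/(fingraph.rootP (@connect_adj_sym _))/dc.
Qed.

(** * The test vector of a separator *)

Section TestVector.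
Variables (R : realType) (G : sgraph) (S : {set G}) (q : nat) (mu : R).
Hypotheses (S_neq0 : S != set0) (mu0 : 0 < mu).
Hypothesis q_lt : (q < components (delete S))%N.
Let M : nat := (#|delete S| - q)%N.
Hypothesis M_lt : M%:R < mu + 1.

Definition test_vector (u : G) : R :=
  if insub u is Some x then #|S|%:R * weight mu (x : delete S) else 1.

Let s_gt0 : 0 < #|S|%:R :> R.
Proof. by rewrite ltr0n card_gt0. Qed.

Lemma test_vector_in u : u \in S -> test_vector u = 1.
Proof. by move=> uS; rewrite /test_vector insubF // uS. Qed.

Lemma test_vector_val (x : delete S) :
  test_vector (val x) = #|S|%:R * weight mu x.
Proof. by rewrite /test_vector valK. Qed.

Lemma test_vector_gt0 u : 0 < test_vector u.
Proof.
rewrite /test_vector; case: insub => // x.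
by rewrite mulr_gt0 // (weight_gt0 mu0 q_lt M_lt).
Qed.

Lemma sum_test_vector (P : pred G) : \sum_(w | P w) test_vector w =
  #|[set w in S | P w]|%:R
  + #|S|%:R * \sum_(x : delete S | P (val x)) weight mu x.
Proof.
rewrite (bigID (mem S)) /=; congr (_ + _).
  rewrite -sum1_card natr_sum; apply: eq_big => [w|w /andP[_ /test_vector_in ->]//].
  by rewrite inE andbC.
rewrite mulr_sumr; under eq_bigl do rewrite andbC.
rewrite (reindex_omap (val : delete S -> G) insub) /=; last first.
  by move=> w /andP[wS _]; rewrite insubT.
apply: eq_big => [x|x _]; first by rewrite (valP x) valK eqxx andbT.
exact: test_vector_val.
Qed.

(** Neighbours outside S lie in the component of [x] and share its weight, so the neighbour sum
    depends only on two counts. *)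
Let out_bound (x : delete S) :
  #|[set w in S | adj (val x) w]|%:R + #|[set y : delete S | adj x y]|%:R * (#|S|%:R * weight mu x)
  = \sum_(w | adj (val x) w) test_vector w.
Proof.
rewrite sum_test_vector; congr (_ + _); rewrite mulrCA; congr (_ * _).
rewrite mulr_natl -sumr_const; apply: eq_big => y; rewrite inE // => xy.
exact/weight_eq/connect1.
Qed.

Let out_eq (x : delete S) : mu * (#|S|%:R * weight mu x) =
  #|S|%:R + (#|component x|.-1)%:R * (#|S|%:R * weight mu x).
Proof.
have xlt := component_lt mu0 q_lt M_lt x.
rewrite /weight -[in LHS](prednK (component_gt0 x)).
rewrite -[in X in _ = X](prednK (component_gt0 x)) -natr1.
move: xlt; rewrite -[in X in X -> _](prednK (component_gt0 x)) -natr1 => xlt.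
by field; rewrite gt_eqF // subr_gt0.
Qed.

Let nbr_sub (x : delete S) : [set y : delete S | adj x y] \subset component x :\ x.
Proof.
apply/subsetP => y; rewrite !inE => xy; rewrite connect1 // andbT.
by apply: contraTneq xy => ->; rewrite adj_irr.
Qed.

Let card_nbr_max (x : delete S) : #|component x :\ x| = #|component x|.-1.
Proof. by rewrite [in RHS](cardsD1 x) inE connect0. Qed.

Lemma test_vector_super :
  (#|S|.-1)%:R + #|S|%:R * (q%:R / mu + M%:R / (mu + 1 - M%:R)) <= mu ->
  forall u, \sum_(w | adj u w) test_vector w <= mu * test_vector u.
Proof.
move=> mu_ge u; case: (boolP (u \in S)) => uS.
  rewrite (test_vector_in uS) mulr1 sum_test_vector; apply: le_trans mu_ge.
  apply: lerD.
    rewrite ler_nat [#|S|](cardsD1 u) uS; apply/subset_leq_card/subsetP => w.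
    rewrite !inE => /andP[-> uw]; rewrite andbT.
    by apply: contraTneq uw => ->; rewrite adj_irr.
  rewrite ler_pM2l //; apply: le_trans (weight_sum_le mu0 q_lt M_lt).
  rewrite big_mkcond; apply: ler_sum => x _; case: ifP => // _.
  exact/ltW/(weight_gt0 mu0 q_lt M_lt).
(* Off S, the two counts are at most |S| and the component size minus one, the values that [out_eq]
   balances exactly. *)
pose x : delete S := Sub u uS; rewrite -[u]/(val x) -out_bound test_vector_val out_eq.
apply: lerD.
  rewrite ler_nat; apply/subset_leq_card/subsetP => w.
  by rewrite inE => /andP[].
rewrite ler_wpM2r ?ler_nat -?card_nbr_max ?subset_leq_card //.
by rewrite -test_vector_val ltW // test_vector_gt0.
Qed.

Hypothesis harmonic : forall u, \sum_(w | adj u w) test_vector w = mu * test_vector u.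

(** Both counts enter the neighbour sum with positive coefficients, so equality in the eigenvalue
    equation forces each to its maximum. *)
Let tight (x : delete S) : #|[set w in S | adj (val x) w]| = #|S| /\
  #|[set y : delete S | adj x y]| = #|component x|.-1.
Proof.
have := harmonic (val x); rewrite -out_bound test_vector_val out_eq.
have W0 : 0 < #|S|%:R * weight mu x by rewrite -test_vector_val test_vector_gt0.
have a_le : (#|[set w in S | adj (val x) w]| <= #|S|)%N.
  by apply/subset_leq_card/subsetP => w; rewrite inE => /andP[].
have b_le : (#|[set y : delete S | adj x y]| <= #|component x|.-1)%N.
  by rewrite -card_nbr_max subset_leq_card.
move: a_le b_le; rewrite leq_eqVlt => /orP[/eqP->|a_lt]; last first.
  move=> b_le E; exfalso.
  have : #|[set w in S | adj (val x) w]|%:R < #|S|%:R :> R by rewrite ltr_nat.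
  have : #|[set y : delete S | adj x y]|%:R * (#|S|%:R * weight mu x)
    <= #|component x|.-1%:R * (#|S|%:R * weight mu x).
    by rewrite ler_pM2r // ler_nat.
  by move: E; lra.
move=> _ /addrI /(mulIf (lt0r_neq0 W0)) /eqP; rewrite eqr_nat => /eqP.
by split.
Qed.

Lemma tight_separator (u v : G) : u \in S -> v \notin S -> adj u v.
Proof.
move=> uS vS; pose x : delete S := Sub v vS; have [E _] := tight x.
have sub : [set w in S | adj (val x) w] \subset S.
  by apply/subsetP => w; rewrite inE => /andP[].
have /eqP/setP/(_ u) : [set w in S | adj (val x) w] == S.
  by rewrite eqEcard sub E leqnn.
by rewrite inE uS adj_sym.
Qed.

Lemma tight_component (x y : delete S) : connect adj x y -> x != y -> adj x y.
Proof.
move=> cxy xy; have [_ E] := tight x.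
have /eqP/setP/(_ y) : [set y : delete S | adj x y] == component x :\ x.
  by rewrite eqEcard nbr_sub E card_nbr_max leqnn.
by rewrite !inE cxy eq_sym xy.
Qed.

(** The only vertex of S has no neighbour in S, so its neighbour sum, equal to mu, is part of the
    total weight. This is the converse of [weight_sum_le] in the equality case. *)
Lemma tight_sum u : u \in S -> #|S| = 1%N ->
  \sum_(x : delete S) weight mu x >= mu.
Proof.
move=> uS S1; have := harmonic u.
rewrite (test_vector_in uS) mulr1 sum_test_vector S1 mul1r => E; rewrite -[X in X <= _]E.
have -> : [set w in S | adj u w] = set0.
  have /cards1P[v Sv] : #|S| == 1%N by rewrite S1.
  apply/setP => w; rewrite !inE; apply/negP => /andP[].
  move: uS; rewrite Sv !inE => /eqP-> /eqP->.
  by rewrite adj_irr.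
rewrite cards0 add0r big_mkcond; apply: ler_sum => x _; case: ifP => // _.
exact/ltW/(weight_gt0 mu0 q_lt M_lt).
Qed.

End TestVector.

(** * Admissibility of n - t - 1 for separators with at least two vertices *)

Lemma rho_super (R : realType) (s t M rho : R) : 2 <= s -> 1 <= t -> 1 <= M ->
  rho = M - 1 + (s + t * (s - 1)) ->
  s - 1 + s * (t * s / rho + M / (rho + 1 - M)) <= rho.
Proof.
(* With n = s + t s + M, [rho] is n - t - 1 and [k] is rho + 1 - M. The bounds s <= k <= rho replace
   every denominator by [k] and split off M - 1. *)
move=> s2 t1 M1; set k := s + t * (s - 1) => rhoE.
have ks : s <= k by rewrite /k; nra.
have k0 : 0 < k by lra.
have rk : k <= rho by lra.
have r0 : 0 < rho by lra.
have -> : rho + 1 - M = k by lra.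
have h1 : t * s / rho <= t * s / k.
  by rewrite ler_pM2l ?lef_pV2 ?posrE //; nra.
have h2 : s * (M / k) <= s / k + (M - 1).
  have -> : s * (M / k) = s / k + (M - 1) * (s / k) by field; rewrite gt_eqF.
  rewrite lerD2l ler_piMr ?subr_ge0 //.
  by rewrite ler_pdivrMr // mul1r.
have h3 : s - 1 + s * (t * s / k) + s / k <= k.
  have -> : s - 1 + s * (t * s / k) + s / k = ((s - 1) * k + t * s ^+ 2 + s) / k.
    by field; rewrite gt_eqF.
  rewrite ler_pdivrMr // -subr_ge0.
  (* What remains is t (t (s - 1)^2 - 1), nonnegative because s >= 2; at s = 1 it would be -t. *)
  have -> : k * k - ((s - 1) * k + t * s ^+ 2 + s) = t * (t * (s - 1) ^+ 2 - 1).
    by rewrite /k; ring.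
  have d1 : 1 <= (s - 1) ^+ 2 by rewrite exprn_ege1 //; lra.
  by apply: mulr_ge0; [lra|rewrite subr_ge0; apply: mulr_ege1].
have h4 : s * (t * s / rho) <= s * (t * s / k) by rewrite ler_pM2l //; lra.
by rewrite mulrDr; lra.
Qed.

(** * Recognising the extremal graph *)

Lemma isomorphic_extremal (G : sgraph) (m t : nat) (v : G) (B : {set G}) :
  (0 < m)%N -> (0 < t)%N -> v \notin B -> #|B| = m -> #|G| = (1 + (m + t))%N ->
  (forall x y, adj x y = (x != y) && [|| x == v, y == v | (x \in B) && (y \in B)]) ->
  isomorphic G (graph_join (complete 1) (graph_union (complete m) (edgeless t))).
Proof.
(* Successor sizes give [inord] its target; the isomorphism numbers [B] and the remaining vertices
   [C] by their place in the enumerations. *)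
case: m t => [//|m] [//|t] _ _ vB Bm Gn adjE.
pose C := ~: (v |: B).
have Ct : #|C| = t.+1.
  by have := cardsC (v |: B); rewrite cardsU1 vB Bm Gn -/C; lia.
pose H := graph_join (complete 1) (graph_union (complete m.+1) (edgeless t.+1)).
pose f (x : G) : H := if x == v then inl ord0 else
  if x \in B then inr (inl (inord (index x (enum B))))
  else inr (inr (inord (index x (enum C)))).
have idx (A : {set G}) k x : #|A| = k.+1 -> x \in A -> (index x (enum A) < k.+1)%N.
  by move=> <- xA; rewrite cardE index_mem mem_enum.
have inj_idx (A : {set G}) k x y : #|A| = k.+1 -> x \in A -> y \in A ->
    inord (index x (enum A)) = inord (index y (enum A)) :> 'I_k.+1 -> x = y.
  move=> Ak xA yA /(congr1 val); rewrite /= !inordK ?idx // => E.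
  by rewrite -(nth_index v (s := enum A) (x := x)) ?mem_enum // E nth_index ?mem_enum.
have inC x : x != v -> x \notin B -> x \in C by rewrite !inE negb_or => -> ->.
have f_inj : injective f.
  move=> x y; rewrite /f; case: (eqVneq x v) => [->|xv]; case: (eqVneq y v) => [->|yv] //.
  - by case: ifP.
  - by case: ifP.
  case: (boolP (x \in B)) => xB; case: (boolP (y \in B)) => yB //.
  - by case=> /(inj_idx _ _ _ _ Bm xB yB).
  - by case=> /(inj_idx _ _ _ _ Ct (inC _ xv xB) (inC _ yv yB)).
exists f.
  apply: inj_card_bij => //.
  by rewrite /= !card_sum !card_ord Gn.
(* Moving x != y to the images turns it into the adjacency test of the complete part. *)
move=> x y; rewrite adjE -(inj_eq f_inj) /f.
case: (eqVneq x v) => [->|xv]; case: (eqVneq y v) => [->|yv] /=; rewrite ?eqxx //.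
- by case: ifP.
- by case: ifP.
by case: (boolP (x \in B)) => xB; case: (boolP (y \in B)) => yB //=;
  rewrite ?andbT ?andbF.
Qed.

(** * From a violated toughness condition to the extremal graph *)

Theorem theorem1p1 (R : realType) (t n : nat) (G : sgraph)
    (t_gt0 : (0 < t)%N)
    (G_conn : connected_graph G)
    (G_order : #|G| = n)
    (n_ge : (t + 2 <= n)%N)
    (G_radius : eta R t n <= lambda1 R G) :
  ~ isomorphic G
      (graph_join (complete 1) (graph_union (complete (n - t - 1)) (edgeless t))) ->
  tough (t%:R^-1 : R) G.
Proof.
move=> not_ext S c_ge2.
have t1 : 1 <= t%:R :> R by rewrite ler1n.
rewrite ler_pdivrMl ?ltr0n // -natrM ler_nat leqNgt; apply/negP => c_gt.
have [rho_lt eta_eq] := etaP R t_gt0 n_ge.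
have S0 := separator_neq0 G_conn c_ge2.
have nE := card_delete S; rewrite G_order in nE.
have := card_components (delete S); move: (\sum_(_ | _) _)%N => k HE.
have Mpos : (0 < #|delete S| - t * #|S|)%N by rewrite HE; lia.
pose M := (#|delete S| - t * #|S|)%N.
have M1 : 1 <= M%:R :> R by rewrite ler1n.
have ME : n%:R = #|S|%:R + t%:R * #|S|%:R + M%:R :> R.
  by rewrite -natrM -!natrD; congr (_%:R); rewrite /M; lia.
have n_ge' : t%:R + 2 <= n%:R :> R by rewrite -natrD ler_nat.
have eigen : eigenvalue (adj_matrix R G) (lambda1 R G).
  by apply: lambda1_eigenvalue; apply: lt_le_trans G_radius; lra.
have [s_ge2|s_lt2] := leqP 2 #|S|.
  have s2 : 2 <= #|S|%:R :> R by rewrite ler_nat.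
  pose rho : R := n%:R - t%:R - 1.
  have rho0 : 0 < rho by rewrite /rho; lra.
  have M_lt : M%:R < rho + 1 by rewrite /rho ME; nra.
  have super := @test_vector_super R G S (t * #|S|) rho S0 rho0 c_gt M_lt.
  (* As rho < eta <= lambda1, superharmonicity would force lambda1 = rho, which is absurd. *)
  have [||||E _] := @superharmonic_eq R G (test_vector S rho) rho (lambda1 R G) G_conn.
  - exact: (@test_vector_gt0 R G S (t * #|S|)).
  - apply: super; rewrite natrM -subn1 natrB ?card_gt0 //.
    by apply: rho_super => //; rewrite /rho ME; ring.
  - exact: eigen.
  - by apply: le_trans G_radius; rewrite ltW.
  by move: G_radius; rewrite E /rho; lra.
have S1 : #|S| = 1%N by move: S0; rewrite -card_gt0; lia.
have /cards1P[v Sv] : #|S| == 1%N by rewrite S1.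
set mu := eta R t n in G_radius rho_lt eta_eq *.
have mu0 : 0 < mu by lra.
have M_lt : M%:R < mu + 1 by rewrite S1 in ME; lra.
(* For |S| = 1, n = 1 + t + M, and the difference of the two sides is minus the cubic over mu (mu +
   1 - M). *)
have mu_eq : (t * #|S|)%:R / mu + M%:R / (mu + 1 - M%:R) = mu.
  rewrite S1 muln1; apply/eqP; rewrite -subr_eq0; apply/eqP.
  have -> : t%:R / mu + M%:R / (mu + 1 - M%:R) - mu =
      - (mu ^+ 3 - (n%:R - t%:R - 2) * mu ^+ 2 - (n%:R - 1) * mu
         + t%:R * (n%:R - t%:R - 2)) / (mu * (mu + 1 - M%:R)).
    by rewrite ME S1; field; rewrite !gt_eqF // subr_gt0.
  by rewrite eta_eq oppr0 mul0r.
have [||||_ harm] := @superharmonic_eq R G (test_vector S mu) mu (lambda1 R G) G_conn.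
- exact: (@test_vector_gt0 R G S (t * #|S|)).
- apply: (@test_vector_super R G S (t * #|S|)) => //.
  by rewrite mu_eq S1 /= add0r mul1r.
- exact: eigen.
- exact: G_radius.
have vS : v \in S by rewrite Sv inE.
(* The total weight is squeezed to its extremal value, which yields t + 1 components, one of them of
   size M. *)
have sumE : \sum_x weight mu (x : delete S) = mu.
  have := weight_sum_le mu0 c_gt M_lt; rewrite mu_eq => sum_le.
  by apply/le_anti; rewrite sum_le (tight_sum mu0 c_gt M_lt harm vS S1).
have [|cE [x xM]] := weight_sum_eq mu0 c_gt M_lt; first by rewrite sumE mu_eq.
apply: not_ext.
have xc : (#|component x| + components (delete S) = #|delete S|.+1)%N.
  by rewrite xM cE; lia.
have valB : #|val @: component x| = (n - t - 1)%N.
  by rewrite card_imset; [rewrite xM; lia|exact: val_inj].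
apply: (@isomorphic_extremal G (n - t - 1) t v (val @: component x)) => //.
- by lia.
- by apply/imsetP => -[y _ E]; have := valP y; rewrite -E vS.
- by rewrite G_order; lia.
have notinS u : (u \notin S) = (u != v) by rewrite Sv inE.
have v_adj u : u != v -> adj v u.
  by rewrite -notinS; exact: (tight_separator S0 mu0 c_gt M_lt harm).
move=> a b; case: (eqVneq a v) => [->|av] /=.
  case: (eqVneq v b) => [<-|vb]; first by rewrite adj_irr.
  by rewrite v_adj // eq_sym.
case: (eqVneq b v) => [->|bv] /=; first by rewrite adj_sym v_adj // av.
have aS : a \notin S by rewrite notinS.
have bS : b \notin S by rewrite notinS.
have [a' ->] : exists a' : delete S, a = val a' by exists (Sub a aS).
have [b' ->] : exists b' : delete S, b = val b' by exists (Sub b bS).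
have inB (z : delete S) : (val z \in val @: component x) = connect adj x z.
  by rewrite mem_imset ?inE //; exact: val_inj.
rewrite !inB (inj_eq val_inj) -[adj (val a') _]/(adj a' b').
(* Away from [v], edges stay inside components: the one of [x] is complete and all others are
   singletons. *)
case: (eqVneq a' b') => [->|ab]; rewrite ?adj_irr // andTb.
case: (boolP (connect adj x a')) => xa; rewrite ?andTb ?andFb.
  apply/idP/idP => [ab'|xb]; first exact: connect_trans xa (connect1 ab').
  apply: (tight_component S0 mu0 c_gt M_lt harm) => //.
  by apply: connect_trans xb; rewrite connect_adj_sym.
apply/negP => /connect1 ab'.
have : b' \in component a' by rewrite inE.
by rewrite (one_big_component xc xa) inE eq_sym (negPf ab).
Qed.
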